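(* For an integer $m\ge 3$ let $H_m=\operatorname{conv}\{(\cos\frac{2k\pi}{m},\sin\frac{2k\pi}{m}) : k=0,1,\dots,m-1\}\subset\mathbb{R}^2$ be the regular $m$-gon. (1) For every integer $n\ge 1$ and every real $t_{4n}>0$, the following statements are equivalent: (i) $t_{4n}H_{4n}$ contains a lattice point of $\mathbb{Z}^2$ in any position; (ii) $t_{4n}H_{4n}$ contains a ball (disc) of radius $\frac{\sqrt2}{2}$; (iii) $t_{4n}\ge Z(H_{4n})$, where $Z(H_{4n})=\dfrac{\sqrt{2}/2}{\cos\frac{\pi}{4n}}$. (2) For $n\in\{1,2\}$ and every real $t_{4n+2}>0$, the following statements are equivalent: (i) $t_{4n+2}H_{4n+2}$ contains a lattice point of $\mathbb{Z}^2$ in any position; (ii) $t_{4n+2}H_{4n+2}$ contains $[-\frac12,\frac12]^2$; (iii) $t_{4n+2}\ge Z(H_{4n+2})$, where $$Z(H_6)=\frac{1}{3-\sqrt3},\qquad Z(H_{10})=\frac{\cos\frac{\pi}{5}-\sin\frac{\pi}{5}+\sin\frac{2\pi}{5}-\cos\frac{2\pi}{5}}{2\sin\frac{\pi}{5}}.$$ (In particular the asserted values of the lattice point covering radii $Z(H_{4n})$, $Z(H_6)$, $Z(H_{10})$ are part of the claim.)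
   Context: A convex body is a compact convex set with non-empty interior. A convex body $K\subset\mathbb{R}^2$ ''contains a lattice point of $\mathbb{Z}^2$ in any position'' (has the lattice point covering property) if for every rotation $o$ of $\mathbb{R}^2$ about the origin and every $\boldsymbol{x}\in\mathbb{R}^2$ the set $o(K)+\boldsymbol{x}$ contains at least one point of $\mathbb{Z}^2$. The lattice point covering radius $Z(K)$ is the smallest positive number $r$ such that $rK$ has the lattice point covering property. *)

(* Defs.v *)
From mathcomp Require Import all_boot all_order all_algebra.
From mathcomp Require Import all_classical all_reals all_analysis.

Set Implicit Arguments.
Unset Strict Implicit.
Unset Printing Implicit Defensive.

Import Order.TTheory GRing.Theory Num.Theory.
Import numFieldNormedType.Exports.

Local Open Scope classical_set_scope.
Local Open Scope ring_scope.

(* The plane is R * R with its product vector space structure. The canonical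
   norm and balls of R * R are those of the max norm, hence the explicit
   Euclidean disc below. *)

Definition rotation (R : realType) (theta : R) (p : R * R) : R * R :=
  (cos theta * p.1 - sin theta * p.2, sin theta * p.1 + cos theta * p.2).

Definition scale_set (R : realType) (t : R) (K : set (R * R)) : set (R * R) :=
  [set t *: p | p in K].

Definition integer_lattice (R : realType) : set (R * R) :=
  [set p | p.1 \is a Num.int /\ p.2 \is a Num.int].
Arguments integer_lattice : clear implicits.

Definition covering_property (R : realType) (K : set (R * R)) : Prop :=
  forall (theta : R) (x : R * R),
    [set rotation theta p + x | p in K] `&` integer_lattice R !=set0.

Definition is_covering_radius (R : realType) (K : set (R * R)) (r : R) : Prop :=
  [/\ 0 < r, covering_property (scale_set r K) &
      forall s : R, 0 < s -> covering_property (scale_set s K) -> r <= s].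

(* The default value 0 signals that there is no covering radius, since
   covering radii are positive. *)
Definition covering_radius (R : realType) (K : set (R * R)) : R :=
  xget 0 [set r | is_covering_radius K r].

Definition convex_hull (R : realType) (A : set (R * R)) : set (R * R) :=
  smallest (@convex_set R (R * R)%type) A.

Definition regular_polygon (R : realType) (m : nat) : set (R * R) :=
  convex_hull [set (cos (2 * k%:R * pi / m%:R), sin (2 * k%:R * pi / m%:R))
              | k in `I_m].
Arguments regular_polygon : clear implicits.

Definition euclidean_disc (R : realType) (c : R * R) (r : R) : set (R * R) :=
  [set p | Num.sqrt ((p.1 - c.1) ^+ 2 + (p.2 - c.2) ^+ 2) <= r].

Definition centered_unit_square (R : realType) : set (R * R) :=
  `[- (1 / 2), 1 / 2] `*` `[- (1 / 2), 1 / 2].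
Arguments centered_unit_square : clear implicits.

(* Main.v *)
(* A regular m-gon with m even is the set of points whose projections on the m
   edge normals are at most the inradius, so covering says that for every angle
   and every x some lattice point z has all projections of z - x on the rotated
   normals at most r.

   For m = 4n, a disc of radius sqrt 2 / 2 always contains a lattice point; if the
   inradius is smaller, rotating four normals onto the diagonals encloses the
   polygon in the open diamond |x - 1/2| + |y - 1/2| < 1, which has none.

   For m = 6 and m = 10, a polygon missing the corners of the unit square misses
   the lattice when centred at (1/2, 1/2).  Conversely, the symmetries of the
   polygon and of the lattice reduce the rotation angle to [0, pi / (2m)].  There
   an explicit point y of the triangle (0,0), (1,0), (0,1), obtained by moving
   (1/2, 1/2) a distance 1/30 parallel to the tightest pair of edges, lies in the
   translates of the polygon K by all three vertices.  By symmetry K + v and K + w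
   also contain the midpoint of each edge vw, so the three translates cover the
   triangle, and its reflections in lattice midpoints give the whole plane. *)

Require Import Defs.
From mathcomp Require Import all_boot all_order all_algebra.
From mathcomp Require Import all_classical all_reals all_analysis.
From mathcomp Require Import ring lra.

Import Order.TTheory GRing.Theory Num.Theory.
Import numFieldNormedType.Exports.

Local Open Scope classical_set_scope.
Local Open Scope ring_scope.

(** * The regular polygon as an intersection of half-planes *)

Lemma convex_setE {R : realType} {M : lmodType R} (A : set M) :
  @convex_set R M A <->
  forall x y (l : R), 0 <= l <= 1 -> A x -> A y -> A (l *: x + (1 - l) *: y).
Proof.
split=> [cA x y l l01 Ax Ay | cA x y l]; last first.
  by rewrite !inE => Ax Ay; apply: cA => //; rewrite ge0 le1.
have [l0 l1] := andP l01.
have := cA x y (Itv01 l0 l1); rewrite !inE; exact.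
Qed.

(** When [a + b] is positive, normalising gives a convex combination of [x] and [y], which is then
    shrunk towards the origin. *)
Lemma convex_star {R : realType} {M : lmodType R} (A : set M) x y (a b : R) :
  @convex_set R M A -> A 0 -> A x -> A y -> 0 <= a -> 0 <= b -> a + b <= 1 ->
  A (a *: x + b *: y).
Proof.
move=> /convex_setE cA A0 Ax Ay a0 b0 ab1.
have [ab0|abN0] := eqVneq (a + b) 0.
  have -> : a = 0 by lra.
  have -> : b = 0 by lra.
  by rewrite !scale0r addr0.
have ab_gt0 : 0 < a + b by rewrite lt_def abN0 addr_ge0.
have := cA (a / (a + b) *: x + (1 - a / (a + b)) *: y) 0 (a + b).
rewrite scaler0 addr0 scalerDr !scalerA.
have -> : (a + b) * (a / (a + b)) = a by field.
have -> : (a + b) * (1 - a / (a + b)) = b by field.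
apply=> //; first by rewrite addr_ge0.
by apply: cA => //; rewrite divr_ge0 ?(ltW ab_gt0)//= ler_pdivrMr// mul1r lerDl.
Qed.

Definition dot {R : realType} (p : R * R) (a : R) : R :=
  p.1 * cos a + p.2 * sin a.

(** The outward normal of the edge joining vertices [k] and [k + 1], midway between their angles.
    Integer indices let shifts and reflections act without reduction modulo [m]. *)
Definition normal_angle {R : realType} (m : nat) (k : int) : R :=
  (2 * k%:~R + 1) * pi / m%:R.

Definition halfplanes {R : realType} (m : nat) (r : R) : set (R * R) :=
  [set p | forall k : int, dot p (normal_angle m k) <= r].

Section Dot.
Context {R : realType}.
Implicit Types (p q : R * R) (a b : R).

Lemma dotD p q a : dot (p + q) a = dot p a + dot q a.
Proof. by rewrite /dot /=; ring. Qed.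

Lemma dotZ (l : R) p a : dot (l *: p) a = l * dot p a.
Proof. by rewrite /dot /= /GRing.scale /=; ring. Qed.

Lemma dotN p a : dot (- p) a = - dot p a.
Proof. by rewrite /dot /=; ring. Qed.

Lemma dotB p q a : dot (p - q) a = dot p a - dot q a.
Proof. by rewrite dotD dotN. Qed.

Lemma dotDpi p a : dot p (a + pi) = - dot p a.
Proof. by rewrite /dot cosDpi sinDpi; ring. Qed.

(** Each half turn flips both signs. Equal factors control absolute values; different ones control
    the signs of consecutive sines. *)
Lemma dotM_addzpi p q a b (k : int) :
  dot p (a + k%:~R * pi) * dot q (b + k%:~R * pi) = dot p a * dot q b.
Proof.
have nonneg (n : nat) a' b' :
    dot p (a' + n%:R * pi) * dot q (b' + n%:R * pi) = dot p a' * dot q b'.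
  elim: n => [|n IHn]; first by rewrite !mul0r !addr0.
  have E c : c + n.+1%:R * pi = c + n%:R * pi + pi :> R by rewrite -natr1; ring.
  by rewrite !E !dotDpi mulrNN.
case: k => n; first exact: nonneg.
rewrite -(nonneg n.+1 (a + _)) NegzE mulrNz !mulNr.
by congr (dot _ _ * dot _ _); rewrite -addrA pmulrn addNr addr0.
Qed.

Lemma normr_dot_addzpi p a (k : int) : `|dot p (a + k%:~R * pi)| = `|dot p a|.
Proof.
by rewrite -!sqrtr_sqr !expr2 dotM_addzpi.
Qed.

(** The normals come in opposite pairs: raising the index by [h] adds a half turn, so Euclidean
    division of [k] by [h] suffices. *)
Lemma dot_le_of_half (h : nat) p a r : (0 < h)%N ->
  (forall j : nat, (j < h)%N -> `|dot p (a + normal_angle (2 * h) j)| <= r) ->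
  forall k : int, `|dot p (a + normal_angle (2 * h) k)| <= r.
Proof.
move=> h0 le_r k.
have hN0 : h%:Z != 0 by rewrite eqz_nat -lt0n.
have hRN0 : h%:R != 0 :> R by rewrite pnatr_eq0 -lt0n.
have := modz_ge0 k hN0; have := ltz_mod k hN0.
have := divz_eq k h; case: (k %% h)%Z => // j -> /= jh _.
suff -> : a + normal_angle (2 * h) ((k %/ h)%Z * h + j) =
    (a + normal_angle (2 * h) j) + (k %/ h)%Z%:~R * pi.
  by rewrite normr_dot_addzpi; apply: le_r.
rewrite /normal_angle natrM intrD intrM.
by rewrite -!pmulrn; field.
Qed.

Lemma sqr_dot_le p a : dot p a ^+ 2 <= p.1 ^+ 2 + p.2 ^+ 2.
Proof.
have := cos2Dsin2 a; have := sqr_ge0 (p.1 * sin a - p.2 * cos a).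
rewrite /dot; move: (cos a) (sin a) => c s ge0 cs1.
have -> : p.1 ^+ 2 + p.2 ^+ 2 = (p.1 ^+ 2 + p.2 ^+ 2) * (c ^+ 2 + s ^+ 2).
  by rewrite cs1 mulr1.
nra.
Qed.

End Dot.

Section RegularPolygon.
Context {R : realType} (m : nat).
Hypotheses (m4 : (4 <= m)%N) (m_even : ~~ odd m).

Let vertex (k : nat) : R * R :=
  (cos (2 * k%:R * pi / m%:R), sin (2 * k%:R * pi / m%:R)).

Let mR_gt0 : 0 < m%:R :> R. Proof. by rewrite ltr0n; case: m m4. Qed.
Let mRN0 : m%:R != 0 :> R. Proof. exact: lt0r_neq0. Qed.

Let halfN0 : m./2%:R != 0 :> R.
Proof. by rewrite pnatr_eq0; case: m m4 => [|[|[|]]]. Qed.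

Let m_half : m%:R = 2 * m./2%:R :> R.
Proof.
by rewrite -[in LHS](odd_double_half m) (negbTE m_even) -mul2n natrM.
Qed.

(** No multiple of [pi] lies strictly between the two angles; dividing [k] by [m] brings both into
    [[0, pi]]. *)
Lemma sin_succ_ge0 (k : int) :
  0 <= sin (k%:~R * pi / m%:R) * sin ((k%:~R + 1) * pi / m%:R) :> R.
Proof.
have sin_dot x : sin x = dot (0, 1) x :> R by rewrite /dot /= mul0r mul1r add0r.
have mN0 : m%:Z != 0 by rewrite eqz_nat; case: m m4.
have := modz_ge0 k mN0; have := ltz_mod k mN0.
have := divz_eq k m; case: (k %% m)%Z => // j -> /= jm _.
have sub (x : R) : 0 <= x <= m%:R -> 0 <= sin (x * pi / m%:R).
  move=> /andP[x0 xm]; apply: sin_ge0_pi.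
  rewrite !mulr_ge0 ?invr_ge0 ?(ltW mR_gt0) ?pi_ge0//=.
  by rewrite ler_pdivrMr// mulrC ler_wpM2l// pi_ge0.
have := mulr_ge0 (sub j%:R _) (sub j.+1%:R _).
rewrite !ler0n !ler_nat (ltnW jm) => /(_ erefl jm).
rewrite !sin_dot -(dotM_addzpi _ _ _ (j.+1%:R * pi / m%:R) (k %/ m)%Z) => /le_trans; apply.
rewrite le_eqVlt; apply/orP; left; apply/eqP.
rewrite intrD intrM -!pmulrn -natr1.
by congr (dot _ _ * dot _ _); field.
Qed.

(** With [b = (k - j) pi / m] and [c = pi / m] the projection is [cos (2b + c)], and [cos c - cos
    (2b + c) = 2 sin b sin (b + c)]. *)
Lemma dot_vertex_le (j : nat) (k : int) :
  dot (vertex j) (normal_angle m k) <= cos (pi / m%:R).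
Proof.
rewrite /dot /= /normal_angle -cosB.
set a := _ - _.
have -> : a = - (2 * ((k - j%:Z)%:~R * pi / m%:R) + pi / m%:R).
  by rewrite /a intrB -!pmulrn; field.
rewrite cosN mulrC mulr_natr.
have := sin_succ_ge0 (k - j%:Z).
have -> : ((k - j%:Z)%:~R + 1) * pi / m%:R =
  (k - j%:Z)%:~R * pi / m%:R + pi / m%:R :> R by field.
set b := _ * pi / _; set c := pi / _.
rewrite cosD cos_mulr2n sin_mulr2n sinD.
have := cos2Dsin2 b.
have <- : 1 - 2 * sin b ^+ 2 = cos b ^+ 2 *+ 2 - 1.
  by rewrite sin2cos2; ring.
nra.
Qed.

(** The index is unbounded so that the successor of the last vertex is available too; periodicity
    reduces it modulo [m]. *)
Lemma vertex_hull (k : nat) : regular_polygon R m (vertex k).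
Proof.
have m0 : (0 < m)%N by case: m m4.
apply: sub_gen_smallest; exists (k %% m)%N; first by rewrite /= ltn_pmod.
rewrite /vertex {3 4}(divn_eq k m).
have -> : 2 * (k %/ m * m + k %% m)%:R * pi / m%:R =
    2 * (k %% m)%:R * pi / m%:R + (pi *+ 2) *+ (k %/ m) :> R.
  by rewrite natrD natrM -mulr_natr -(mulr_natr pi); field.
by rewrite (periodicn (@cosD2pi R)) (periodicn (@sinD2pi R)).
Qed.

Lemma convex_regular_polygon :
  @convex_set R (R * R)%type (regular_polygon R m).
Proof.
apply: (iffRL (convex_setE _)) => x y l l01 hx hy C [cC sC].
by apply: (iffLR (convex_setE _) cC) => //; [apply: hx|apply: hy].
Qed.

Lemma regular_polygon0 : regular_polygon R m 0.
Proof.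
have := iffLR (convex_setE _) convex_regular_polygon.
(* The origin is the midpoint of two opposite vertices, since [m] is even. *)
have -> : 0 = 2^-1 *: vertex 0 + (1 - 2^-1) *: vertex m./2.
  rewrite /vertex !mulr0 !mul0r.
  have -> : 2 * m./2%:R * pi / m%:R = pi :> R.
    by rewrite m_half; field; rewrite halfN0.
  by rewrite cos0 sin0 cospi sinpi; congr pair; rewrite /= /GRing.scale /=; field.
apply; [by apply/andP; split; lra|exact: vertex_hull|exact: vertex_hull].
Qed.

Lemma discrete_sign_change (f : nat -> R) (a n : nat) :
  0 <= f a -> f (a + n.+1)%N <= 0 -> exists k, 0 <= f k /\ f k.+1 <= 0.
Proof.
elim: n a => [|n IHn] a fa fan; first by exists a; rewrite -addn1.
have [fS|/ltW fS] := lerP (f a.+1) 0; first by exists a.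
by apply: (IHn a.+1) => //; rewrite addSnnS.
Qed.

(* [dot p (theta_k + pi / 2)] is the cross product of the [k]-th vertex with
   [p]; it changes sign between two consecutive vertices, and [p] is a
   nonnegative combination of these. *)
Lemma regular_polygonE : regular_polygon R m = halfplanes m (cos (pi / m%:R)).
Proof.
apply/seteqP; split.
  apply: smallest_sub => [|_ [k _ <-]]; last by move=> j; apply: dot_vertex_le.
  apply: (iffRL (convex_setE _)) => x y l /andP[l0 l1] hx hy k.
  rewrite dotD !dotZ; have := hx k; have := hy k; nra.
move=> p hp; pose f k : R := dot p (2 * k%:R * pi / m%:R + pi / 2).
have fh k : f (k + m./2)%N = - f k.
  rewrite /f -dotDpi; congr dot.
  by rewrite natrD m_half; field; rewrite halfN0.
(* A shift by [m./2] negates [f], so the search starts at [0] or at [m./2], whichever has a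
   nonnegative value. *)
have [k [fk fk1]] : exists k, 0 <= f k /\ f k.+1 <= 0.
  have h0 : m./2 = (m./2).-1.+1 by case: m m4 => [|[|]].
  have [f0|/ltW f0] := lerP 0 (f 0%N).
    by apply: (discrete_sign_change f 0 (m./2).-1); rewrite // -h0 fh oppr_le0.
  apply: (discrete_sign_change f (m./2) (m./2).-1).
    by rewrite -[X in f X]add0n fh oppr_ge0.
  by rewrite -h0 fh -[X in f X]add0n fh opprK.
pose s : R := sin (2 * pi / m%:R).
have pim : 0 < pi / m%:R :> R by rewrite divr_gt0// pi_gt0.
have m4R : 4 <= m%:R :> R by rewrite ler_nat.
have pim4 : pi / m%:R <= pi / 4 :> R.
  by rewrite ler_pM2l ?pi_gt0// lef_pV2// posrE.
have s0 : 0 < s.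
  apply: sin_gt0_pi; rewrite -mulrA; apply/andP; split; first by lra.
  have := @pi_gt0 R; lra.
have c0 : 0 < cos (pi / m%:R) :> R.
  apply: cos_gt0_pihalf; apply/andP; split; have := @pi_gt0 R; lra.
have := hp k; rewrite /normal_angle.
pose A : R := 2 * k%:R * pi / m%:R.
have E1 : 2 * k.+1%:R * pi / m%:R = A + 2 * pi / m%:R.
  by rewrite /A -natr1; field.
have -> : (2 * k%:~R + 1) * pi / m%:R = A + pi / m%:R.
  by rewrite /A; field.
have fkE : f k = cos A * p.2 - sin A * p.1.
  by rewrite /f /dot cosDpihalf sinDpihalf -/A; ring.
have fk1E : f k.+1 = cos (A + 2 * pi / m%:R) * p.2 - sin (A + 2 * pi / m%:R) * p.1.
  by rewrite /f /dot E1 cosDpihalf sinDpihalf; ring.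
have sE : s = 2 * sin (pi / m%:R) * cos (pi / m%:R).
  rewrite /s -mulrA [2 * _]mulrC mulr_natr sin_mulr2n; ring.
have cE : cos (2 * pi / m%:R) = 1 - 2 * sin (pi / m%:R) ^+ 2 :> R.
  by rewrite -mulrA [2 * _]mulrC mulr_natr cos_mulr2n sin2cos2; ring.
(* Cramer's rule in the basis of the two vertices, whose determinant is [s]. *)
have pE : p = (- f k.+1 / s) *: vertex k + (f k / s) *: vertex k.+1.
  rewrite [LHS]surjective_pairing; congr pair;
  rewrite /= /GRing.scale /= E1 -/A fkE fk1E cosD sinD -/s;
  have := cos2Dsin2 A; set cA := cos A; set sA := sin A => cs1.
    transitivity ((cA ^+ 2 + sA ^+ 2) * p.1); first by rewrite cs1 mul1r.
    by field; rewrite lt0r_neq0.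
  transitivity ((cA ^+ 2 + sA ^+ 2) * p.2); first by rewrite cs1 mul1r.
  by field; rewrite lt0r_neq0.
move=> pk; rewrite pE; apply: convex_star; first exact: convex_regular_polygon.
- exact: regular_polygon0.
- exact: vertex_hull.
- exact: vertex_hull.
- by rewrite divr_ge0 ?(ltW s0)// oppr_ge0.
- by rewrite divr_ge0 ?(ltW s0).
(* Multiplied by [s * cos (pi / m)], the sum of the coefficients becomes [s] times the projection of
   [p] on the normal between the two vertices. *)
rewrite -mulrDl ler_pdivrMr// mul1r -(ler_pM2l c0) fkE fk1E.
suff -> : cos (pi / m%:R) * (- (cos (A + 2 * pi / m%:R) * p.2 -
    sin (A + 2 * pi / m%:R) * p.1) + (cos A * p.2 - sin A * p.1)) =
    dot p (A + pi / m%:R) * s.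
  by rewrite ler_pM2r.
rewrite /dot !cosD !sinD -/s cE sE.
ring.
Qed.

End RegularPolygon.

(** * Lattice coverings *)

(** Turning the polygon by [theta] adds [theta] to every normal, so no rotation of points
    remains. *)
Definition covered {R : realType} (m : nat) (r theta : R) : Prop :=
  forall x : R * R, exists2 z : R * R, integer_lattice R z &
    forall k : int, dot (z - x) (theta + normal_angle m k) <= r.

Section Covering.
Context {R : realType}.
Implicit Types (p q x : R * R) (m : nat) (r t theta : R) (K : set (R * R)).

Lemma rotation_opp theta p : rotation theta (rotation (- theta) p) = p.
Proof.
rewrite /rotation /= cosN sinN [RHS]surjective_pairing.
have cs1 := cos2Dsin2 theta; congr pair.
  by transitivity ((cos theta ^+ 2 + sin theta ^+ 2) * p.1); [ring|rewrite cs1 mul1r].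
by transitivity ((cos theta ^+ 2 + sin theta ^+ 2) * p.2); [ring|rewrite cs1 mul1r].
Qed.

Lemma dot_rotation theta p a : dot (rotation theta p) (theta + a) = dot p a.
Proof.
have {2}-> : a = theta + a - theta by ring.
by rewrite /dot /rotation cosB sinB /=; ring.
Qed.

Lemma scale_setE t K p : 0 < t -> scale_set t K p <-> K (t^-1 *: p).
Proof.
move=> t0; split=> [[q Kq <-]|Kp].
  by rewrite scalerA mulVf ?lt0r_neq0// scale1r.
by exists (t^-1 *: p) => //; rewrite scalerA mulfV ?lt0r_neq0// scale1r.
Qed.

Lemma scale_halfplanes t m r : 0 < t ->
  scale_set t (halfplanes m r) = halfplanes m (t * r).
Proof.
move=> t0; apply/seteqP; split=> p.
  by move=> /(scale_setE _ _ _ t0) Kp k; have := Kp k; rewrite dotZ ler_pdivrMl.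
by move=> Kp; apply/(scale_setE _ _ _ t0) => k; rewrite dotZ ler_pdivrMl.
Qed.

Lemma covering_halfplanes m r :
  covering_property (halfplanes m r) <-> forall theta, covered m r theta.
Proof.
split=> cov theta x.
  have [_ [[p Kp <-] zZ]] := cov theta x.
  exists (rotation theta p + x) => // k.
  by rewrite addrK dot_rotation.
have [z zZ Kz] := cov theta x.
exists z; split=> //; exists (rotation (- theta) (z - x)).
  by move=> k; rewrite -(dot_rotation theta) rotation_opp.
by rewrite rotation_opp subrK.
Qed.

Lemma covering_disc (c : R * R) K :
  euclidean_disc c (Num.sqrt 2 / 2) `<=` K -> covering_property K.
Proof.
move=> cK theta x.
pose c' := rotation theta c + x.
(* Rounding to a nearest integer moves each coordinate by at most 1/2, hence the centre by at most
   [sqrt 2 / 2]. *)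
pose near (y : R) : R := (Num.floor (y + 2^-1))%:~R.
have nearP y : (near y - y) ^+ 2 <= 4^-1.
  have := floor_le_tmp (y + 2^-1); have := floorD1_gt (y + 2^-1).
  rewrite intrD -/(near y) => ? ?; nra.
have [z zZ zc] : exists2 z, integer_lattice R z &
    (z.1 - c'.1) ^+ 2 + (z.2 - c'.2) ^+ 2 <= 2^-1.
  exists (near c'.1, near c'.2); first by split; apply: intr_int.
  by have := nearP c'.1; have := nearP c'.2; rewrite /=; lra.
exists z; split=> //; exists (rotation (- theta) (z - x)); last by rewrite rotation_opp subrK.
apply: cK; rewrite /euclidean_disc /=.
have -> : Num.sqrt 2 / 2 = Num.sqrt (2^-1 : R).
  rewrite -[LHS]ger0_norm ?divr_ge0 ?sqrtr_ge0// -sqrtr_sqr expr_div_n sqr_sqrtr//.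
  by congr Num.sqrt; field.
apply: ler_wsqrtr.
apply: le_trans zc; rewrite le_eqVlt; apply/orP; left; apply/eqP.
rewrite /c' /rotation /= cosN sinN.
have := cos2Dsin2 theta; move: (cos theta) (sin theta) => co si cs1.
(* The inner product of [c] with [z - x] rotated back; once it is isolated, only [cos ^ 2 + sin ^ 2]
   has to be replaced by 1. *)
pose C := c.1 * (co * (z.1 - x.1) + si * (z.2 - x.2))
  + c.2 * (co * (z.2 - x.2) - si * (z.1 - x.1)).
transitivity ((co ^+ 2 + si ^+ 2) * ((z.1 - x.1) ^+ 2 + (z.2 - x.2) ^+ 2)
  + (c.1 ^+ 2 + c.2 ^+ 2) - 2 * C); first by rewrite /C; ring.
transitivity ((z.1 - x.1) ^+ 2 + (z.2 - x.2) ^+ 2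
  + (co ^+ 2 + si ^+ 2) * (c.1 ^+ 2 + c.2 ^+ 2) - 2 * C); last by rewrite /C; ring.
by rewrite cs1 !mul1r.
Qed.

(** A least element is unique, so [xget] returns [r] and not its default value. *)
Lemma covering_radius_threshold K r : 0 < r ->
  (forall t, 0 < t -> covering_property (scale_set t K) <-> r <= t) ->
  is_covering_radius K r /\ covering_radius K = r.
Proof.
move=> r0 Kr.
have rP : is_covering_radius K r.
  by split=> // [|s s0]; [apply/Kr|move/Kr; apply].
split=> //; apply: xget_unique => // s [s0 sP smin].
by apply/eqP; rewrite eq_le smin ?rP//=; [apply/Kr|apply/Kr].
Qed.

(** * Symmetries acting on the rotation angle *)

Section Reduction.
Variables (m : nat) (r : R).
Hypothesis m_gt0 : (0 < m)%N.

Let mRN0 : m%:R != 0 :> R. Proof. by rewrite pnatr_eq0 -lt0n. Qed.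

Lemma covered_shift (j : int) theta :
  covered m r theta -> covered m r (theta + 2 * j%:~R * pi / m%:R).
Proof.
move=> cov x; have [z zZ zK] := cov x; exists z => // k.
have := zK (k + j); rewrite /normal_angle intrD.
suff -> : theta + (2 * (k%:~R + j%:~R) + 1) * pi / m%:R =
  theta + 2 * j%:~R * pi / m%:R + (2 * k%:~R + 1) * pi / m%:R by [].
by field.
Qed.

Lemma covered_quarter theta : covered m r theta -> covered m r (theta + pi / 2).
Proof.
move=> cov x; have [z [z1 z2] zK] := cov (x.2, - x.1).
exists (- z.2, z.1); first by split=> //=; rewrite rpredN.
move=> k; have := zK k; rewrite addrAC /dot /= cosDpihalf sinDpihalf.
by apply: le_trans; rewrite le_eqVlt; apply/orP; left; apply/eqP; ring.
Qed.

Lemma covered_opp theta : covered m r theta -> covered m r (- theta).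
Proof.
move=> cov x; have [z [z1 z2] zK] := cov (x.1, - x.2).
exists (z.1, - z.2); first by split=> //=; rewrite rpredN.
(* The index [- k - 1] gives the opposite angle, as [2 (- k - 1) + 1 = - (2 k + 1)]. *)
move=> k; have := zK (- k - 1); rewrite /dot /=.
have -> : theta + normal_angle m (- k - 1) = - (- theta + normal_angle m k).
  by rewrite /normal_angle intrB mulrNz; field.
rewrite cosN sinN.
by apply: le_trans; rewrite le_eqVlt; apply/orP; left; apply/eqP; ring.
Qed.

(** For [m = 4 q + 2] a quarter turn is [(2 q + 1) pi / m]; undoing [q] rotations of the polygon by
    [2 pi / m] leaves [pi / m]. *)
Lemma covered_step theta : (m %% 4 = 2)%N ->
  covered m r theta -> covered m r (theta + pi / m%:R).
Proof.
move=> m42 /covered_quarter /(covered_shift (- (m %/ 4)%:Z)).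
rewrite mulrNz -pmulrn.
have mE : m%:R = 4 * (m %/ 4)%:R + 2 :> R.
  by rewrite [in LHS](divn_eq m 4) m42 natrD natrM mulrC.
suff -> : theta + pi / 2 + 2 * - (m %/ 4)%:R * pi / m%:R = theta + pi / m%:R by [].
have -> : (m %/ 4)%:R = (m%:R - 2) / 4 :> R by rewrite mE; field.
by field.
Qed.

Lemma covered_steps (j : int) theta : (m %% 4 = 2)%N ->
  covered m r theta -> covered m r (theta + j%:~R * pi / m%:R).
Proof.
move=> m42; have nonneg (n : nat) a :
    covered m r a -> covered m r (a + n%:R * pi / m%:R).
  move=> ca; elim: n => [|n IHn]; first by rewrite !mul0r addr0.
  have -> : a + n.+1%:R * pi / m%:R = a + n%:R * pi / m%:R + pi / m%:R.
    by rewrite -natr1; field.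
  exact: covered_step.
case: j => n cov; first exact: nonneg.
have -> : theta + (Negz n)%:~R * pi / m%:R = - (- theta + n.+1%:R * pi / m%:R).
  by rewrite NegzE mulrNz -pmulrn; field.
by apply: covered_opp; apply: nonneg; apply: covered_opp.
Qed.

(** Steps of [pi / m] bring the angle into [[0, pi / m)], and a reflection combined with a step
    folds this interval in half. *)
Lemma covered_reduction : (m %% 4 = 2)%N ->
  (forall theta, 0 <= theta <= pi / (2 * m%:R) -> covered m r theta) ->
  forall theta, covered m r theta.
Proof.
move=> m42 cov theta.
have pim : 0 < pi / m%:R :> R by rewrite divr_gt0 ?pi_gt0// ltr0n.
pose j := Num.floor (theta / (pi / m%:R)).
pose a := theta - j%:~R * pi / m%:R.
have aE : a = theta - j%:~R * (pi / m%:R) by rewrite /a mulrA.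
have a0 : 0 <= a.
  by rewrite aE subr_ge0 -ler_pdivlMr// floor_le_tmp.
have a1 : a < pi / m%:R.
  have : theta < (j%:~R + 1) * (pi / m%:R).
    by rewrite -ltr_pdivrMr// -(intrD _ _ 1) floorD1_gt.
  rewrite aE; lra.
have -> : theta = a + j%:~R * pi / m%:R by rewrite /a subrK.
apply: covered_steps => //.
have halfE : pi / (2 * m%:R) = (pi / m%:R) / 2 :> R by field.
have [ah|/ltW ah] := lerP a (pi / (2 * m%:R)).
  by apply: cov; rewrite a0.
have -> : a = - ((pi / m%:R - a) + (-1)%:~R * pi / m%:R).
  by rewrite mulrN1z; field.
apply: covered_opp; apply: covered_steps => //; apply: cov.
rewrite halfE in ah *; lra.
Qed.

End Reduction.

(** * Covering the plane by lattice translates of a symmetric convex set *)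

Section TriangleCover.
Variable K : set (R * R).
Hypotheses (cK : @convex_set R (R * R)%type K) (sK : forall p, K p -> K (- p)).

(** The midpoint of [v] and [w] lies in both translates, because [(w - v) / 2] is the midpoint of
    [y - v] and [- (y - w)]. The median from [y] then splits the triangle, and the larger of [a] and
    [b] selects the half. *)
Lemma cover_near_edge (v w y : R * R) (g a b : R) :
  0 <= g -> 0 <= a -> 0 <= b -> g + a + b = 1 -> K (y - v) -> K (y - w) ->
  K (g *: y + a *: v + b *: w - v) \/ K (g *: y + a *: v + b *: w - w).
Proof.
have aux v' w' a' b' : 0 <= g -> 0 <= b' -> b' <= a' -> g + a' + b' = 1 ->
    K (y - v') -> K (y - w') -> K (g *: y + a' *: v' + b' *: w' - v').
  move=> g0 b0 ba sum1 Kv Kw.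
  have Kwv : K (2^-1 *: (w' - v')).
    have -> : 2^-1 *: (w' - v') = 2^-1 *: (y - v') + (1 - 2^-1) *: (- (y - w')).
      by congr pair; rewrite /= /GRing.scale /=; field.
    by apply: (iffLR (convex_setE _) cK) => //; [lra|exact: sK].
  have K0 : K 0.
    have -> : 0 = 2^-1 *: (y - v') + (1 - 2^-1) *: (- (y - v')).
      by congr pair; rewrite /= /GRing.scale /=; field.
    by apply: (iffLR (convex_setE _) cK) => //; [lra|exact: sK].
  have -> : g *: y + a' *: v' + b' *: w' - v' =
      g *: (y - v') + (2 * b') *: (2^-1 *: (w' - v')).
    have -> : a' = 1 - g - b' by lra.
    by congr pair; rewrite /= /GRing.scale /=; field.
  by apply: convex_star => //; lra.
move=> g0 a0 b0 sum1 Kv Kw; have [ba|/ltW ab] := lerP b a.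
  by left; apply: aux.
by right; rewrite (addrAC (g *: y)); apply: aux => //; lra.
Qed.

Variable y : R * R.
Hypotheses (y1 : 0 < y.1) (y2 : 0 < y.2) (y12 : y.1 + y.2 < 1).
Hypotheses (Ky : K y) (Ky1 : K (y - (1, 0))) (Ky2 : K (y - (0, 1))).

(* The translates of [K] by the vertices of the triangle [(0,0), (1,0), (0,1)]
   all contain [y]; the point [q] lies in the subtriangle spanned by [y] and the
   edge opposite to the vertex with the least ratio of the barycentric
   coordinates of [q] and [y]. *)
Lemma triangle_cover (q : R * R) : 0 <= q.1 -> 0 <= q.2 -> q.1 + q.2 <= 1 ->
  exists2 v : R * R, integer_lattice R v & K (q - v).
Proof.
move=> q1 q2 q12.
have Z0 : integer_lattice R (0, 0) by split; rewrite rpred0.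
have Z1 : integer_lattice R (1, 0) by split; rewrite ?rpred0 ?rpred1.
have Z2 : integer_lattice R (0, 1) by split; rewrite ?rpred0 ?rpred1.
have Ky0 : K (y - (0, 0)) by rewrite subr0.
have pick (v w : R * R) (g a b : R) : integer_lattice R v -> integer_lattice R w ->
    K (y - v) -> K (y - w) -> 0 <= g -> 0 <= a -> 0 <= b -> g + a + b = 1 ->
    q = g *: y + a *: v + b *: w ->
    exists2 v : R * R, integer_lattice R v & K (q - v).
  move=> Zv Zw Kv Kw g0 a0 b0 sum1 ->.
  by have [] := cover_near_edge v w y g a b g0 a0 b0 sum1 Kv Kw;
     [exists v|exists w].
(* The quotients are kept in product form, so that the later identities are linear in the
   monomials. *)
have ratio (a b : R) : 0 <= a -> 0 < b -> exists2 g : R, 0 <= g & g * b = a.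
  move=> a0 b0; exists (a / b); first by rewrite divr_ge0 ?(ltW b0).
  by rewrite divfK ?lt0r_neq0.
have u0 : 0 < 1 - y.1 - y.2 by have := y12; lra.
have l0 : 0 <= 1 - q.1 - q.2 by rewrite -addrA -opprD subr_ge0.
have [g0 g0_ge0 g0E] := ratio _ _ l0 u0.
have [g1 g1_ge0 g1E] := ratio _ _ q1 y1.
have [g2 g2_ge0 g2E] := ratio _ _ q2 y2.
have qE a b c d : a = b -> c = d -> (a, c) = (b, d) :> R * R by move=> -> ->.
have [/andP[g01 g02]|/andP[g10 g12]|/andP[g20 g21]] :
    [\/ (g0 <= g1) && (g0 <= g2), (g1 <= g0) && (g1 <= g2) |
        (g2 <= g0) && (g2 <= g1)].
- have [a|/ltW a] := leP g0 g1.
    have [b|/ltW b] := leP g0 g2; first by constructor 1.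
    by constructor 3; rewrite b (le_trans b a).
  have [b|/ltW b] := leP g1 g2; first by constructor 2; rewrite a.
  by constructor 3; rewrite b (le_trans b a).
- apply: (pick (1, 0) (0, 1) g0 ((g1 - g0) * y.1) ((g2 - g0) * y.2)) => //.
  + by apply: mulr_ge0; [rewrite subr_ge0|exact: ltW].
  + by apply: mulr_ge0; [rewrite subr_ge0|exact: ltW].
  + lra.
  rewrite [LHS]surjective_pairing; apply: qE; rewrite /= /GRing.scale /=; lra.
- apply: (pick (0, 0) (0, 1) g1 ((g0 - g1) * (1 - y.1 - y.2))
    ((g2 - g1) * y.2)) => //.
  + by apply: mulr_ge0; [rewrite subr_ge0|exact: ltW].
  + by apply: mulr_ge0; [rewrite subr_ge0|exact: ltW].
  + lra.
  rewrite [LHS]surjective_pairing; apply: qE; rewrite /= /GRing.scale /=; lra.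
apply: (pick (0, 0) (1, 0) g2 ((g0 - g2) * (1 - y.1 - y.2))
    ((g1 - g2) * y.1)) => //.
- by apply: mulr_ge0; [rewrite subr_ge0|exact: ltW].
- by apply: mulr_ge0; [rewrite subr_ge0|exact: ltW].
- lra.
rewrite [LHS]surjective_pairing; apply: qE; rewrite /= /GRing.scale /=; lra.
Qed.

Lemma lattice_cover (x : R * R) :
  exists2 z : R * R, integer_lattice R z & K (z - x).
Proof.
pose n1 := Num.floor x.1; pose n2 := Num.floor x.2.
pose f := x.1 - n1%:~R; pose g := x.2 - n2%:~R.
have f0 : 0 <= f by rewrite subr_ge0 floor_le_tmp.
have g0 : 0 <= g by rewrite subr_ge0 floor_le_tmp.
have f1 : f < 1.
  by have := floorD1_gt x.1; rewrite intrD -/n1 /f; lra.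
have g1 : g < 1.
  by have := floorD1_gt x.2; rewrite intrD -/n2 /g; lra.
have xE : x = (f + n1%:~R, g + n2%:~R).
  by rewrite !subrK -surjective_pairing.
have [fg|/ltW fg] := lerP (f + g) 1.
  have [v [v1 v2] Kv] := triangle_cover (f, g) f0 g0 fg.
  exists (v.1 + n1%:~R, v.2 + n2%:~R).
    by split; rewrite rpredD ?intr_int.
  suff -> : (v.1 + n1%:~R, v.2 + n2%:~R) - x = - ((f, g) - v) by apply: sK.
  by rewrite xE; congr pair; rewrite /=; ring.
(* The upper triangle of the unit square is reflected in [(1/2, 1/2)] onto the lower one. *)
have [||| v [v1 v2] Kv] := triangle_cover (1 - f, 1 - g); rewrite /=; try lra.
exists (1 + n1%:~R - v.1, 1 + n2%:~R - v.2).
  by split; rewrite rpredB ?rpredD ?rpred1 ?intr_int.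
suff -> : (1 + n1%:~R - v.1, 1 + n2%:~R - v.2) - x = (1 - f, 1 - g) - v by [].
by rewrite xE; congr pair; rewrite /=; ring.
Qed.

End TriangleCover.

End Covering.

(** * The hexagon and the decagon cover at the critical size *)

Section SpecialAngles.
Context {R : realType}.

Lemma cos_piquarter : cos (pi / 4) = Num.sqrt 2 / 2 :> R.
Proof.
have pi0 := @pi_gt0 R.
have c0 : 0 < cos (pi / 4) :> R by apply: cos_gt0_pihalf; lra.
have cs : sin (pi / 4) = cos (pi / 4) :> R.
  by rewrite -cosBpihalf -[RHS]cosN; congr cos; field.
have := cos2Dsin2 (pi / 4 : R); rewrite cs => c1.
have s0 : 0 <= Num.sqrt 2 :> R by rewrite sqrtr_ge0.
have s2 : Num.sqrt 2 ^+ 2 = 2 :> R by rewrite sqr_sqrtr.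
nra.
Qed.

Lemma sin_piquarter : sin (pi / 4) = Num.sqrt 2 / 2 :> R.
Proof.
by rewrite -cos_piquarter -cosBpihalf -[RHS]cosN; congr cos; field.
Qed.

Lemma sqrt3_bounds : 19 / 11 <= Num.sqrt (3 : R) <= 7 / 4.
Proof.
have s0 : 0 <= Num.sqrt 3 :> R by rewrite sqrtr_ge0.
have s2 : Num.sqrt 3 ^+ 2 = 3 :> R by rewrite sqr_sqrtr.
by apply/andP; split; nra.
Qed.

Lemma cos_pi6_sin_pi6 : cos (pi / 6) = Num.sqrt 3 / 2 :> R /\ sin (pi / 6) = 1 / 2 :> R.
Proof.
have pi0 := @pi_gt0 R.
have c0 : 0 < cos (pi / 6) :> R by apply: cos_gt0_pihalf; lra.
have s1 : sin (pi / 6) = 1 / 2 :> R.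
  have : sin (pi / 6 *+ 2) = cos (pi / 6) :> R.
    by rewrite -cosBpihalf -[RHS]cosN; congr cos; field.
  rewrite sin_mulr2n; nra.
split=> //; have := cos2Dsin2 (pi / 6 : R); rewrite s1 => c1.
have s0 : 0 <= Num.sqrt 3 :> R by rewrite sqrtr_ge0.
have s2 : Num.sqrt 3 ^+ 2 = 3 :> R by rewrite sqr_sqrtr.
nra.
Qed.

(* From [sin (2 * pi / 5) = sin (3 * pi / 5)]. *)
Lemma cos_pi5_quadratic : 4 * cos (pi / 5) ^+ 2 = 2 * cos (pi / 5) + 1 :> R.
Proof.
have pi0 := @pi_gt0 R.
have s0 : 0 < sin (pi / 5) :> R by apply: sin_gt0_pi; lra.
have : sin (pi / 5 *+ 2) = sin (pi / 5 *+ 2 + pi / 5) :> R.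
  have -> : pi / 5 *+ 2 + pi / 5 = - (pi / 5 *+ 2) + pi :> R by field.
  by rewrite sinDpi sinN opprK.
rewrite (sinD (pi / 5 *+ 2)) sin_mulr2n cos_mulr2n.
have := cos2Dsin2 (pi / 5 : R).
move: (sin (pi / 5)) (cos (pi / 5)) s0 => s c s0 cs E.
apply: (mulfI (lt0r_neq0 s0)).
lra.
Qed.

Lemma cos_pi5_bounds : 21 / 26 <= cos (pi / 5 : R) <= 17 / 21.
Proof.
have pi0 := @pi_gt0 R.
have c0 : 0 < cos (pi / 5) :> R by apply: cos_gt0_pihalf; lra.
have := cos_pi5_quadratic; move: (cos _) c0 => c c0 cq.
by apply/andP; split; nra.
Qed.

Lemma sin_pi5_bounds : 7 / 12 <= sin (pi / 5 : R) <= 13 / 22.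
Proof.
have pi0 := @pi_gt0 R.
have s0 : 0 < sin (pi / 5) :> R by apply: sin_gt0_pi; lra.
have := cos2Dsin2 (pi / 5 : R); have := cos_pi5_quadratic.
have /andP[] := cos_pi5_bounds.
move: (cos (pi / 5)) (sin (pi / 5)) s0 => c s s0 c1 c2 cq cs.
(* The quadratic equation makes [s ^+ 2] affine in [c]. *)
have {cq cs} s2 : s ^+ 2 = 3 / 4 - c / 2 by lra.
by apply/andP; split; nra.
Qed.

End SpecialAngles.

(** * Projection inequalities for the displaced point [y] *)

Section Cells.
Context {R : realType}.
Implicit Types (r phi theta beta kappa M : R).

(** Both bounds on the sum follow from [(cos phi + sin phi) ^ 2 = 1 + sin (2 phi)]. *)
Lemma first_quadrant_bound phi M : 0 <= phi <= pi / 2 -> 0 <= M ->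
  sin (phi *+ 2) <= M ^+ 2 - 1 ->
  [/\ `|cos phi - sin phi| <= 1, 1 <= cos phi + sin phi
    & cos phi + sin phi <= M].
Proof.
move=> /andP[phi0 phi1] M0; have pi0 := @pi_gt0 R.
have c0 : 0 <= cos phi by apply: cos_ge0_pihalf; lra.
have s0 : 0 <= sin phi by apply: sin_ge0_pi; lra.
have := cos2Dsin2 phi; rewrite sin_mulr2n.
move: (cos phi) (sin phi) c0 s0 => c s c0 s0 cs1 csM.
by split; [rewrite ler_norml; apply/andP; split| |]; nra.
Qed.

(* With [beta] the direction of a normal of the rotated polygon and
   [y = (1/2, 1/2) - (sin beta, - cos beta) / 30], this says that the
   projections of [y], [y - (1,0)] and [y - (0,1)] on the direction [phi] are at
   most [r] in absolute value, where [kappa = sin (beta - phi)]. *)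
Definition cell r phi kappa : Prop :=
  `|cos phi + sin phi - kappa / 15| <= 2 * r /\
  `|cos phi - sin phi| + `|kappa| / 15 <= 2 * r.

(** Here the sum is the large projection, and a nonnegative [kappa] lowers it. The constant
    [16 / 15] bounds [1 + kappa / 15] for the difference. *)
Lemma cell_first_quadrant r phi kappa M : 0 <= phi <= pi / 2 -> 0 <= M ->
  sin (phi *+ 2) <= M ^+ 2 - 1 -> 0 <= kappa <= 1 ->
  M - kappa / 15 <= 2 * r -> 16 / 15 <= 2 * r -> cell r phi kappa.
Proof.
move=> phiq M0 sM /andP[k0 k1] Mr r1; rewrite /cell (ger0_norm k0).
have [cs1 cs2 cs3] := first_quadrant_bound phi M phiq M0 sM.
by split; [rewrite ler_norml; lra|lra].
Qed.

(** A quarter turn exchanges sum and difference, so the displacement costs [kappa / 15] in absolute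
    value, whatever its sign. *)
Lemma cell_second_quadrant r phi kappa M : 0 <= phi <= pi / 2 -> 0 <= M ->
  sin (phi *+ 2) <= M ^+ 2 - 1 -> `|kappa| <= 1 ->
  M + `|kappa| / 15 <= 2 * r -> 16 / 15 <= 2 * r -> cell r (phi + pi / 2) kappa.
Proof.
move=> phiq M0 sM k1 Mr r1; rewrite /cell cosDpihalf sinDpihalf.
have [] := first_quadrant_bound phi M phiq M0 sM.
move: (cos phi) (sin phi) => c s; rewrite ler_norml => /andP[cs0 cs1] cs2 cs3.
have := ler_norm kappa; have := ler_norm (- kappa); rewrite normrN => ? ?.
split; first by rewrite ler_norml; lra.
rewrite -normrN opprB opprK ger0_norm; lra.
Qed.

Lemma covered_of_cells (h : nat) r theta beta : (0 < h)%N ->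
  0 < sin beta - cos beta ->
  (forall j : nat, (j < h)%N ->
    cell r (theta + normal_angle (2 * h) j)
      (sin (beta - (theta + normal_angle (2 * h) j)))) ->
  covered (2 * h) r theta.
Proof.
move=> h0 sc cells.
pose K : set (R * R) :=
  [set p | forall k : int, `|dot p (theta + normal_angle (2 * h) k)| <= r].
pose y : R * R := (1 / 2 - sin beta / 30, 1 / 2 + cos beta / 30).
have cK : @convex_set R (R * R)%type K.
  apply: (iffRL (convex_setE _)) => p q l /andP[l0 l1] Kp Kq k.
  rewrite dotD !dotZ; have := Kp k; have := Kq k.
  rewrite !ler_norml => /andP[? ?] /andP[? ?].
  by apply/andP; split; nra.
have sK p : K p -> K (- p) by move=> Kp k; rewrite dotN normrN; apply: Kp.
have dot_y phi :
    dot y phi = (cos phi + sin phi - sin (beta - phi) / 15) / 2.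
  by rewrite /dot /y sinB /=; field.
have [[s1 s2] [c1 c2]] : (-1 <= sin beta /\ sin beta <= 1) /\
    (-1 <= cos beta /\ cos beta <= 1).
  by rewrite sin_geN1 sin_le1 cos_geN1 cos_le1.
have y1 : 0 < y.1 by rewrite /y /=; lra.
have y2 : 0 < y.2 by rewrite /y /=; lra.
(* The sum is [1 - (sin beta - cos beta) / 30]: the displacement must point into the triangle. *)
have y12 : y.1 + y.2 < 1 by rewrite /y /=; lra.
have Ky : K y.
  apply: dot_le_of_half => // j jh; have [+ _] := cells j jh.
  rewrite dot_y; move: (_ - _ / 15) => a; rewrite !ler_norml => /andP[? ?].
  by lra.
have Ky1 : K (y - (1, 0)).
  apply: dot_le_of_half => // j jh; have [_] := cells j jh.
  rewrite dotB dot_y /dot /= mul1r mul0r addr0.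
  move: (theta + _) => phi; move: (sin (beta - phi)) => k.
  have := ler_norm (cos phi - sin phi); have := ler_norm (sin phi - cos phi).
  have := ler_norm k; have := ler_norm (- k); rewrite normrN (distrC (sin phi)).
  move: `|k| `|_ - _| => a b ? ? ? ? ?.
  by rewrite ler_norml; lra.
have Ky2 : K (y - (0, 1)).
  apply: dot_le_of_half => // j jh; have [_] := cells j jh.
  rewrite dotB dot_y /dot /= mul1r mul0r add0r.
  move: (theta + _) => phi; move: (sin (beta - phi)) => k.
  have := ler_norm (cos phi - sin phi); have := ler_norm (sin phi - cos phi).
  have := ler_norm k; have := ler_norm (- k); rewrite normrN (distrC (sin phi)).
  move: `|k| `|_ - _| => a b ? ? ? ? ?.
  by rewrite ler_norml; lra.
move=> x; have [z zZ Kz] := lattice_cover _ cK sK _ y1 y2 y12 Ky Ky1 Ky2 x.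
by exists z => // k; apply: le_trans (ler_norm _) _.
Qed.

Lemma ler_sin (x y : R) : - (pi / 2) <= x -> x <= y -> y <= pi / 2 -> sin x <= sin y :> R.
Proof.
move=> x1 + y1; rewrite le_eqVlt => /predU1P[->//|xy].
apply: ltW; rewrite ltr_sin//.
all: by rewrite in_itv/=; lra.
Qed.

Lemma sin_pisub x : sin (pi - x) = sin x :> R.
Proof. by rewrite addrC sinDpi sinN opprK. Qed.

Lemma covered_hexagon theta : covered 6 ((Num.sqrt 3 + 1) / 4) theta.
Proof.
apply: covered_reduction => // {}theta /andP[theta0 theta1].
have pi0 := @pi_gt0 R; have [c6 s6] := @cos_pi6_sin_pi6 R.
have theta2 : theta <= pi / 12.
  by apply: le_trans theta1 _; rewrite le_eqVlt; apply/orP; left; apply/eqP; field.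
have /andP[w1 w2] := @sqrt3_bounds R.
have w0 : Num.sqrt 3 ^+ 2 = 3 :> R by rewrite sqr_sqrtr.
have s3 : sin (pi / 3) = Num.sqrt 3 / 2 :> R.
  by rewrite -c6 -cosBpihalf -[RHS]cosN; congr cos; field.
have phiB : 0 <= theta + pi / 3 <= pi / 2 by lra.
(* [beta] is the third normal, so [y] moves along that pair of edges and [kappa] vanishes there. *)
apply: (@covered_of_cells 3 _ _ (theta + pi / 3 + pi / 2)) => //.
  have sM : sin ((theta + pi / 3) *+ 2) <= 2 ^+ 2 - 1.
    by apply: le_trans (sin_le1 _) _; lra.
  have [_ + _] := first_quadrant_bound _ 2 phiB (ler0n _ _) sM.
  by rewrite cosDpihalf sinDpihalf; lra.
case=> [|[|[|//]]] _; rewrite /normal_angle -pmulrn.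
- have -> : theta + pi / 3 + pi / 2 - (theta + (2 * 0%:R + 1) * pi / (2 * 3)%:R)
    = pi - pi / 3 by field.
  have -> : theta + (2 * 0%:R + 1) * pi / (2 * 3)%:R = theta + pi / 6 by field.
  rewrite sin_pisub s3.
  (* [17 / 12] exceeds [sqrt 2], the maximum of the sum; the displacement compensates for its excess
     over [2 * r]. *)
  apply: (@cell_first_quadrant _ _ _ (17 / 12)); try lra.
  by apply: le_trans (sin_le1 _) _; lra.
- have -> : theta + pi / 3 + pi / 2 - (theta + (2 * 1%:R + 1) * pi / (2 * 3)%:R)
    = pi / 3 by field.
  have -> : theta + (2 * 1%:R + 1) * pi / (2 * 3)%:R = theta + pi / 2 by field.
  rewrite s3.
  apply: (@cell_second_quadrant _ _ _ (5 / 4)).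
  + lra.
  + lra.
  + apply: (@le_trans _ _ (sin (pi / 6))); last by rewrite s6; lra.
    by apply: ler_sin; lra.
  + by rewrite ger0_norm; lra.
  + by rewrite ger0_norm; lra.
  + lra.
have -> : theta + (2 * 2%:R + 1) * pi / (2 * 3)%:R = theta + pi / 3 + pi / 2 by field.
rewrite subrr sin0.
(* Here [M = 2 * r], with equality at [theta = 0], since [M ^ 2 - 1 = sin (pi / 3)]. *)
apply: (@cell_second_quadrant _ _ _ ((Num.sqrt 3 + 1) / 2)) => //.
- have -> : (theta + pi / 3) *+ 2 = pi - (pi / 3 - theta *+ 2) by field.
  rewrite sin_pisub; apply: (@le_trans _ _ (sin (pi / 3))); last by rewrite s3; lra.
  by apply: ler_sin; lra.
- by rewrite normr0.
- by rewrite normr0; lra.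
- lra.
Qed.

Lemma covered_decagon theta :
  covered 10 ((cos (pi / 5) + sin (pi / 5)) / 2) theta.
Proof.
apply: covered_reduction => // {}theta /andP[theta0 theta1].
(* After this reflection the second-quadrant normal that is tight at angle 0 turns away from the
   diagonal: [pi / 5 - theta] stays below [pi / 4]. *)
rewrite -[theta]opprK; apply: covered_opp => //.
have pi0 := @pi_gt0 R.
have theta2 : theta <= pi / 20.
  by apply: le_trans theta1 _; rewrite le_eqVlt; apply/orP; left; apply/eqP; field.
have /andP[c1 c2] := @cos_pi5_bounds R.
have /andP[s1 s2] := @sin_pi5_bounds R.
have cs1 := cos2Dsin2 (pi / 5 : R).
have s25 : sin (pi / 5 *+ 2) = 2 * cos (pi / 5) * sin (pi / 5) :> R.
  by rewrite sin_mulr2n; ring.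
have s310 : sin (3 * pi / 10) = cos (pi / 5) :> R.
  by rewrite -cosBpihalf -[RHS]cosN; congr cos; field.
have s25b : 9 / 10 <= sin (pi / 5 *+ 2 : R) <= 1.
  by rewrite sin_le1 andbT s25; nra.
have phiB : 0 <= pi / 5 - theta <= pi / 2 by lra.
apply: (@covered_of_cells 5 _ _ (pi / 5 - theta + pi / 2)) => //.
  have sM : sin ((pi / 5 - theta) *+ 2) <= 2 ^+ 2 - 1.
    by apply: le_trans (sin_le1 _) _; lra.
  have [_ + _] := first_quadrant_bound _ 2 phiB (ler0n _ _) sM.
  by rewrite cosDpihalf sinDpihalf; lra.
case=> [|[|[|[|[|//]]]]] _; rewrite /normal_angle -pmulrn.
- have -> : pi / 5 - theta + pi / 2 - (- theta + (2 * 0%:R + 1) * pi / (2 * 5)%:R)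
    = pi - pi / 5 *+ 2 by field.
  have -> : - theta + (2 * 0%:R + 1) * pi / (2 * 5)%:R = pi / 10 - theta by field.
  rewrite sin_pisub.
  apply: (@cell_first_quadrant _ _ _ (24 / 19)); try lra.
  apply: (@le_trans _ _ (sin (pi / 5))); last by lra.
  by apply: ler_sin; lra.
- have -> : pi / 5 - theta + pi / 2 - (- theta + (2 * 1%:R + 1) * pi / (2 * 5)%:R)
    = pi / 5 *+ 2 by field.
  have -> : - theta + (2 * 1%:R + 1) * pi / (2 * 5)%:R = 3 * pi / 10 - theta by field.
  apply: (@cell_first_quadrant _ _ _ (17 / 12)); try lra.
  by apply: le_trans (sin_le1 _) _; lra.
- have -> : pi / 5 - theta + pi / 2 - (- theta + (2 * 2%:R + 1) * pi / (2 * 5)%:R)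
    = pi / 5 by field.
  have -> : - theta + (2 * 2%:R + 1) * pi / (2 * 5)%:R = pi / 2 - theta by field.
  apply: (@cell_first_quadrant _ _ _ (24 / 19)); try lra.
  have -> : (pi / 2 - theta) *+ 2 = pi - theta *+ 2 by field.
  rewrite sin_pisub; apply: (@le_trans _ _ (sin (pi / 5))); last by lra.
  by apply: ler_sin; lra.
- have -> : - theta + (2 * 3%:R + 1) * pi / (2 * 5)%:R = pi / 5 - theta + pi / 2.
    by field.
  rewrite subrr sin0.
  (* The tight pair again: [M = 2 * r] and [M ^ 2 - 1 = sin (2 pi / 5)]. *)
  apply: (@cell_second_quadrant _ _ _ (cos (pi / 5) + sin (pi / 5))) => //.
  + lra.
  + apply: (@le_trans _ _ (sin (pi / 5 *+ 2))); last by rewrite s25; nra.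
    by apply: ler_sin; lra.
  + by rewrite normr0.
  + by rewrite normr0; lra.
  + lra.
have -> : pi / 5 - theta + pi / 2 - (- theta + (2 * 4%:R + 1) * pi / (2 * 5)%:R)
  = - (pi / 5) by field.
have -> : - theta + (2 * 4%:R + 1) * pi / (2 * 5)%:R = pi / 5 *+ 2 - theta + pi / 2.
  by field.
rewrite sinN.
(* [(35 / 26) ^ 2 - 1] just exceeds [17 / 21], the upper bound for [cos (pi / 5)]. *)
apply: (@cell_second_quadrant _ _ _ (35 / 26)).
- by lra.
- lra.
- have -> : (pi / 5 *+ 2 - theta) *+ 2 = pi - (pi / 5 + theta *+ 2) by field.
  rewrite sin_pisub; apply: (@le_trans _ _ (sin (3 * pi / 10))).
    by apply: ler_sin; lra.
  by rewrite s310; lra.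
- by rewrite normrN ger0_norm; lra.
- by rewrite normrN ger0_norm; lra.
- lra.
Qed.

End Cells.

(** * Covering radii *)

Section Thresholds.
Context {R : realType}.
Implicit Types (r t phi : R) (z p : R * R).

(* The centre of a lattice square is the position in which too small a polygon
   misses the lattice. *)
Lemma lattice_dot_ge z phi r :
  integer_lattice R z -> 0 <= cos phi -> 0 <= sin phi ->
  `|dot (z - (1 / 2, 1 / 2)) phi| <= r -> `|dot (z - (1 / 2, 1 / 2)) (- phi)| <= r ->
  (cos phi + sin phi) / 2 <= r.
Proof.
move=> [/intrP[a za] /intrP[b zb]] c0 s0.
rewrite /dot /= za zb cosN sinN !ler_norml.
have half (k : int) : (k%:~R : R) <= 0 \/ 1 <= (k%:~R : R).
  have [k0|k0] := leP k 0; first by left; rewrite lerz0.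
  by right; rewrite ler1z -gtz0_ge1.
move: (cos phi) (sin phi) c0 s0 => c s c0 s0.
(* Both coordinates are at least 1/2 in absolute value, and one of the directions [phi], [- phi]
   gives the two terms equal signs. *)
by case: (half a) => a1; case: (half b) => b1 /andP[? ?] /andP[? ?]; nra.
Qed.

Lemma halfplanes_abs (h : nat) r p (k : int) : (0 < h)%N ->
  halfplanes (2 * h) r p -> `|dot p (normal_angle (2 * h) k)| <= r.
Proof.
move=> h0 Kp; have hN0 : h%:R != 0 :> R by rewrite pnatr_eq0 -lt0n.
rewrite ler_norml lerNl Kp andbT.
have := Kp (k + h); suff -> : normal_angle (2 * h) (k + h) =
  normal_angle (2 * h) k + pi :> R by rewrite dotDpi.
by rewrite /normal_angle intrD -pmulrn natrM; field.
Qed.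

Lemma scale_regular_polygon (m : nat) t : (4 <= m)%N -> ~~ odd m -> 0 < t ->
  scale_set t (regular_polygon R m) = halfplanes m (t * cos (pi / m%:R)).
Proof. by move=> m4 me t0; rewrite regular_polygonE// scale_halfplanes. Qed.

Lemma cos_pi_div_gt0 (m : nat) : (4 <= m)%N -> 0 < cos (pi / m%:R) :> R.
Proof.
move=> m4; have pi0 := @pi_gt0 R.
have m0 : 0 < m%:R :> R by rewrite ltr0n (leq_trans _ m4).
apply: cos_gt0_pihalf; apply/andP; split.
  by apply: (@lt_trans _ _ 0); [lra|exact: divr_gt0].
by rewrite ltr_pM2l// ltf_pV2 ?posrE// ltr_nat (leq_trans _ m4).
Qed.

(** The normals with index a multiple of [n] are a quarter turn apart; rotating by
    [pi / 4 - pi / (4 n)] puts them on the diagonals. *)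
Lemma covering_4n_ge (n : nat) r : (1 <= n)%N ->
  covering_property (halfplanes (4 * n) r) -> Num.sqrt 2 / 2 <= r.
Proof.
move=> n1 /covering_halfplanes cov.
have [z zZ Kz] := cov (pi / 4 - pi / (4 * n)%:R) (1 / 2, 1 / 2).
have nN0 : n%:R != 0 :> R by rewrite pnatr_eq0 -lt0n.
have Kk (j : nat) : `|dot (z - (1 / 2, 1 / 2)) (pi / 4 + j%:R * pi / 2)| <= r.
  have E (i : nat) : pi / 4 - pi / (4 * n)%:R + normal_angle (4 * n) (i * n)%N =
      pi / 4 + i%:R * pi / 2 :> R.
    by rewrite /normal_angle -pmulrn !natrM; field.
  rewrite ler_norml lerNl -E Kz andbT -dotDpi.
  have := Kz (j.+2 * n)%N; rewrite !E.
  suff -> : pi / 4 + j.+2%:R * pi / 2 = pi / 4 + j%:R * pi / 2 + pi :> R by [].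
  by rewrite -addn2 natrD; field.
have s0 : 0 <= Num.sqrt 2 / 2 :> R by rewrite divr_ge0 ?sqrtr_ge0.
have := lattice_dot_ge z (pi / 4) r zZ.
rewrite cos_piquarter sin_piquarter => /(_ s0 s0) H.
have := Kk 1%N; have := Kk 0%N.
rewrite !mul0r addr0 => K0 K1.
suff : (Num.sqrt 2 / 2 + Num.sqrt 2 / 2) / 2 <= r by lra.
apply: H => //; move: K1.
have -> : pi / 4 + 1%:R * pi / 2 = - (pi / 4) + pi :> R by field.
by rewrite dotDpi normrN.
Qed.

Lemma disc_sub_halfplanes (m : nat) r : 0 <= r ->
  euclidean_disc (0 : R * R) r `<=` halfplanes m r.
Proof.
move=> r0 p; rewrite /euclidean_disc /= !subr0 => pr k.
apply: le_trans pr; apply: le_trans (ler_norm _) _.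
by rewrite -sqrtr_sqr ler_wsqrtr// sqr_dot_le.
Qed.

Lemma regular_polygon_4n (n : nat) : (1 <= n)%N ->
  [/\ is_covering_radius (regular_polygon R (4 * n))
        (covering_radius (regular_polygon R (4 * n))),
      covering_radius (regular_polygon R (4 * n)) =
        (Num.sqrt 2 / 2) / cos (pi / (4 * n)%:R) &
      forall t : R, 0 < t ->
        [<-> covering_property (scale_set t (regular_polygon R (4 * n)));
             exists c : R * R,
               euclidean_disc c (Num.sqrt 2 / 2)
                 `<=` scale_set t (regular_polygon R (4 * n));
             covering_radius (regular_polygon R (4 * n)) <= t]].
Proof.
move=> n1.
have m4 : (4 <= 4 * n)%N by rewrite leq_pmulr.
have me : ~~ odd (4 * n) by rewrite oddM.
have c0 := cos_pi_div_gt0 _ m4.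
have s0 : 0 < Num.sqrt 2 / 2 :> R by rewrite divr_gt0 ?sqrtr_gt0.
have to_disc t : 0 < t -> (Num.sqrt 2 / 2) / cos (pi / (4 * n)%:R) <= t ->
    euclidean_disc (0 : R * R) (Num.sqrt 2 / 2) `<=`
      scale_set t (regular_polygon R (4 * n)).
  move=> t0; rewrite ler_pdivrMr// scale_regular_polygon// => rt p /= pr.
  by apply: disc_sub_halfplanes; [lra|exact: le_trans rt].
have from_cov t : 0 < t -> covering_property (scale_set t (regular_polygon R (4 * n))) ->
    (Num.sqrt 2 / 2) / cos (pi / (4 * n)%:R) <= t.
  move=> t0; rewrite scale_regular_polygon// ler_pdivrMr//.
  exact: covering_4n_ge.
have [|t t0|rP rE] := covering_radius_threshold (regular_polygon R (4 * n))
    ((Num.sqrt 2 / 2) / cos (pi / (4 * n)%:R)).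
- exact: divr_gt0.
- by split; [exact: from_cov|move=> /to_disc -/(_ t0); exact: covering_disc].
(* The equivalences are closed as a cycle, with the explicit threshold linking covering to the
   centred disc. *)
rewrite rE; split=> // t t0; split; [|split].
- by move=> /(from_cov _ t0) /(to_disc _ t0); exists 0.
- by move=> [c /covering_disc]; exact: from_cov.
- by move=> /(to_disc _ t0); exact: covering_disc.
Qed.

(* [psi] is the direction of the normals for which the half-plane constraint is
   tight at the corners of the unit square. *)
Lemma covering_by_square (h : nat) (psi : R) (k : int) : (2 <= h)%N ->
  psi = normal_angle (2 * h) k -> 0 <= cos psi -> 0 <= sin psi ->
  (forall j : nat, (j < h)%N ->
    `|dot (1, 1) (normal_angle (2 * h) j)| <= cos psi + sin psi /\
    `|dot (1, -1) (normal_angle (2 * h) j)| <= cos psi + sin psi) ->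
  (forall theta, covered (2 * h) ((cos psi + sin psi) / 2) theta) ->
  let K := regular_polygon R (2 * h) in
  [/\ is_covering_radius K (covering_radius K),
      covering_radius K = (cos psi + sin psi) / 2 / cos (pi / (2 * h)%:R) &
      forall t : R, 0 < t ->
        [<-> covering_property (scale_set t K);
             centered_unit_square R `<=` scale_set t K;
             covering_radius K <= t]].
Proof.
move=> h2 psiE c0 s0 Hj cov K.
have h0 : (0 < h)%N by apply: leq_trans h2.
have m4 : (4 <= 2 * h)%N by rewrite (leq_mul2l 2 2).
have me : ~~ odd (2 * h) by rewrite oddM.
have cm := cos_pi_div_gt0 _ m4.
set T := (cos psi + sin psi) / 2; set Z := T / _.
have T0 : 0 < T.
  rewrite divr_gt0// lt_def addr_ge0// andbT; apply/eqP => cs.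
  have := cos2Dsin2 psi; have -> : cos psi = 0 by lra.
  have -> : sin psi = 0 by lra.
  by lra.
have ZT t : (Z <= t) = (T <= t * cos (pi / (2 * h)%:R)) by rewrite ler_pdivrMr.
have square_sub t : 0 < t -> Z <= t -> centered_unit_square R `<=` scale_set t K.
  move=> t0; rewrite ZT scale_regular_polygon// => Tt p.
  move=> [/=]; rewrite !in_itv /= => /andP[p1 p2] /andP[q1 q2] j.
  apply: le_trans Tt.
  (* The corners of the square are plus or minus half of these two vectors; the signs of the cosine
     and sine tell which corner is extremal. *)
  have diag (q : R * R) : q = (1, 1) \/ q = (1, -1) ->
      `|dot q (normal_angle (2 * h) j)| <= 2 * T.
    move=> qE; rewrite -[normal_angle _ _]add0r; apply: dot_le_of_half => // i ih.
    rewrite add0r /T mulrC divfK//; have [] := Hj i ih.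
    by case: qE => ->.
  have := diag _ (or_introl erefl); have := diag _ (or_intror erefl).
  rewrite /dot /= !ler_norml; move: (cos _) (sin _) => c s /andP[? ?] /andP[? ?].
  have [c1|/ltW c1] := leP 0 c; have [s1|/ltW s1] := leP 0 s; nra.
have from_square t : 0 < t -> centered_unit_square R `<=` scale_set t K -> Z <= t.
  move=> t0; rewrite ZT scale_regular_polygon// => sub.
  have /sub /(_ k) : centered_unit_square R (1 / 2, 1 / 2).
    by split; rewrite /= in_itv /=; lra.
  by rewrite -psiE /dot /T /=; lra.
have to_cov t : 0 < t -> Z <= t -> covering_property (scale_set t K).
  move=> t0; rewrite ZT scale_regular_polygon// => Tt.
  apply/covering_halfplanes => theta x; have [z zZ Kz] := cov theta x.
  by exists z => // j; apply: le_trans Tt.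
have from_cov t : 0 < t -> covering_property (scale_set t K) -> Z <= t.
  move=> t0; rewrite ZT scale_regular_polygon// => /covering_halfplanes cv.
  have [z zZ Kz] := cv 0 (1 / 2, 1 / 2).
  have {}Kz : halfplanes (2 * h) (t * cos (pi / (2 * h)%:R)) (z - (1 / 2, 1 / 2)).
    by move=> j; rewrite -[normal_angle _ _]add0r.
  apply: (lattice_dot_ge z) => //; first by rewrite psiE; apply: halfplanes_abs.
  (* The unrotated polygon is symmetric in the horizontal axis, so [- psi] is a normal direction as
     well. *)
  suff -> : - psi = normal_angle (2 * h) (- k - 1) by apply: halfplanes_abs.
  rewrite psiE /normal_angle intrB mulrNz.
  by field; rewrite pnatr_eq0 -lt0n.
have [|t t0|rP rE] := covering_radius_threshold K Z.
- exact: divr_gt0.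
- by split; [exact: from_cov|exact: to_cov].
rewrite rE; split=> // t t0; split; [|split].
- by move=> /(from_cov _ t0); exact: square_sub.
- exact: from_square.
- exact: to_cov.
Qed.

Lemma regular_hexagon :
  let K := regular_polygon R 6 in
  [/\ is_covering_radius K (covering_radius K),
      covering_radius K = 1 / (3 - Num.sqrt 3) &
      forall t : R, 0 < t ->
        [<-> covering_property (scale_set t K);
             centered_unit_square R `<=` scale_set t K;
             covering_radius K <= t]].
Proof.
have pi0 := @pi_gt0 R; have [c6 s6] := @cos_pi6_sin_pi6 R.
have /andP[w1 w2] := @sqrt3_bounds R.
have w0 : Num.sqrt 3 ^+ 2 = 3 :> R by rewrite sqr_sqrtr.
have [||||||rP rE tfae] := covering_by_square 3 (pi / 6) 0.
- by [].
- by rewrite /normal_angle; field.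
- by rewrite c6; lra.
- by rewrite s6; lra.
- rewrite c6 s6; case=> [|[|[|//]]] _; rewrite /normal_angle -pmulrn /dot /=.
  + have -> : (2 * 0%:R + 1) * pi / (2 * 3)%:R = pi / 6 :> R by field.
    by rewrite c6 s6 !ler_norml; lra.
  + have -> : (2 * 1%:R + 1) * pi / (2 * 3)%:R = pi / 2 :> R by field.
    by rewrite cos_pihalf sin_pihalf !ler_norml; lra.
  have -> : (2 * 2%:R + 1) * pi / (2 * 3)%:R = - (pi / 6) + pi :> R by field.
  by rewrite cosDpi sinDpi cosN sinN c6 s6 !ler_norml; lra.
- move=> theta; rewrite c6 s6.
  have -> : (Num.sqrt 3 / 2 + 1 / 2) / 2 = (Num.sqrt 3 + 1) / 4 :> R by field.
  exact: covered_hexagon.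
split=> //; rewrite rE c6 s6.
have d0 : 3 - Num.sqrt 3 != 0 :> R by rewrite lt0r_neq0//; lra.
have d1 : Num.sqrt 3 / 2 != 0 :> R by rewrite lt0r_neq0//; lra.
by apply/eqP; rewrite eqr_div//; apply/eqP; lra.
Qed.

Lemma regular_decagon :
  let K := regular_polygon R 10 in
  [/\ is_covering_radius K (covering_radius K),
      covering_radius K =
        (cos (pi / 5) - sin (pi / 5) + sin (2 * pi / 5) - cos (2 * pi / 5))
          / (2 * sin (pi / 5)) &
      forall t : R, 0 < t ->
        [<-> covering_property (scale_set t K);
             centered_unit_square R `<=` scale_set t K;
             covering_radius K <= t]].
Proof.
have pi0 := @pi_gt0 R.
have /andP[c1 c2] := @cos_pi5_bounds R.
have /andP[s1 s2] := @sin_pi5_bounds R.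
have cq := @cos_pi5_quadratic R.
have c310 : cos (3 * pi / 10) = sin (pi / 5) :> R.
  by rewrite -cosBpihalf -[RHS]cosN; congr cos; field.
have s310 : sin (3 * pi / 10) = cos (pi / 5) :> R.
  by rewrite -cosBpihalf -[RHS]cosN; congr cos; field.
have s25 : sin (2 * pi / 5) = 2 * cos (pi / 5) * sin (pi / 5) :> R.
  have -> : 2 * pi / 5 = pi / 5 *+ 2 :> R by field.
  by rewrite sin_mulr2n; ring.
have c25 : cos (2 * pi / 5) = cos (pi / 5) - 1 / 2 :> R.
  have -> : 2 * pi / 5 = pi / 5 *+ 2 :> R by field.
  by rewrite cos_mulr2n; lra.
have c10 : cos (pi / 10) = 2 * cos (pi / 5) * sin (pi / 5) :> R.
  by rewrite -s25 -cosBpihalf -[RHS]cosN; congr cos; field.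
have s10 : sin (pi / 10) = cos (pi / 5) - 1 / 2 :> R.
  by rewrite -c25 -cosBpihalf -[RHS]cosN; congr cos; field.
have csB : 2 * cos (pi / 5) * sin (pi / 5) <= 1 :> R by rewrite -s25 sin_le1.
have cs0 : 9 / 10 <= 2 * cos (pi / 5) * sin (pi / 5) :> R by nra.
(* Among the normals in the first quadrant, [3 pi / 10] is closest to the diagonal and so maximises
   [cos + sin]. *)
have [||||||rP rE tfae] := covering_by_square 5 (3 * pi / 10) 1.
- by [].
- by rewrite /normal_angle; field.
- by rewrite c310; lra.
- by rewrite s310; lra.
- rewrite c310 s310; case=> [|[|[|[|[|//]]]]] _; rewrite /normal_angle -pmulrn /dot /=.
  + have -> : (2 * 0%:R + 1) * pi / (2 * 5)%:R = pi / 10 :> R by field.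
    by rewrite c10 s10 !ler_norml; lra.
  + have -> : (2 * 1%:R + 1) * pi / (2 * 5)%:R = 3 * pi / 10 :> R by field.
    by rewrite c310 s310 !ler_norml; lra.
  + have -> : (2 * 2%:R + 1) * pi / (2 * 5)%:R = pi / 2 :> R by field.
    by rewrite cos_pihalf sin_pihalf !ler_norml; lra.
  + have -> : (2 * 3%:R + 1) * pi / (2 * 5)%:R = - (3 * pi / 10) + pi :> R by field.
    by rewrite cosDpi sinDpi cosN sinN c310 s310 !ler_norml; lra.
  have -> : (2 * 4%:R + 1) * pi / (2 * 5)%:R = - (pi / 10) + pi :> R by field.
  by rewrite cosDpi sinDpi cosN sinN c10 s10 !ler_norml; lra.
- by move=> theta; rewrite c310 s310 addrC; exact: covered_decagon.
split=> //; rewrite rE c310 s310 s25 c25.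
have -> : cos (pi / (2 * 5)%:R) = 2 * cos (pi / 5) * sin (pi / 5) :> R by [].
move: (cos (pi / 5)) (sin (pi / 5)) cq c1 s1 {c2 s2 s25 c25 c10 s10 c310 s310 rE csB cs0}.
move=> c s cq c1 s1.
have d0 : 2 * c * s != 0 by rewrite !mulf_neq0 ?lt0r_neq0//; lra.
have d1 : 2 * s != 0 by rewrite mulf_neq0 ?lt0r_neq0//; lra.
(* After cross-multiplication the two forms of the radius differ by [s ^ 2] times the quadratic
   relation for [cos (pi / 5)]. *)
have cqs : 4 * c ^+ 2 * (s * s) = (2 * c + 1) * (s * s) by rewrite cq.
by apply/eqP; rewrite eqr_div//; apply/eqP; lra.
Qed.

End Thresholds.

Theorem theorem1p4 (R : realType) :
  (forall n : nat, (1 <= n)%N ->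
    [/\ is_covering_radius (regular_polygon R (4 * n))
          (covering_radius (regular_polygon R (4 * n))),
        covering_radius (regular_polygon R (4 * n)) =
          (Num.sqrt 2 / 2) / cos (pi / (4 * n)%:R) &
        forall t : R, 0 < t ->
          [<-> covering_property (scale_set t (regular_polygon R (4 * n)));
               exists c : R * R,
                 euclidean_disc c (Num.sqrt 2 / 2)
                   `<=` scale_set t (regular_polygon R (4 * n));
               covering_radius (regular_polygon R (4 * n)) <= t]]) /\
  [/\ forall n : nat, n = 1%N \/ n = 2%N ->
        is_covering_radius (regular_polygon R (4 * n + 2))
          (covering_radius (regular_polygon R (4 * n + 2))) /\
        forall t : R, 0 < t ->
          [<-> covering_property (scale_set t (regular_polygon R (4 * n + 2)));
               centered_unit_square R `<=` scale_set t (regular_polygon R (4 * n + 2));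
               covering_radius (regular_polygon R (4 * n + 2)) <= t],
      covering_radius (regular_polygon R 6) = 1 / (3 - Num.sqrt 3) &
      covering_radius (regular_polygon R 10) =
        (cos (pi / 5) - sin (pi / 5) + sin (2 * pi / 5) - cos (2 * pi / 5))
          / (2 * sin (pi / 5))].
Proof.
split; first exact: regular_polygon_4n.
have [hex hexE hext] := @regular_hexagon R.
have [dec decE dect] := @regular_decagon R.
by split=> // n [] ->.
Qed.
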